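(* Let $\boldsymbol{\theta}=(\theta^{(n)})_{n\ge 0}$ be a torsion-free directive sequence with length sequence $(q_n)_{n\ge 0}$, defined on a sequence of alphabets $(\mathcal A_n)_{n\ge 0}$ of bounded size. Then $\boldsymbol\theta$ is quasi-recognizable, i.e. there is a factor map $(X_{\boldsymbol\theta},\sigma)\to(\mathbb Z_{(q_n)},+1)$.
   Context: Alphabets are finite sets. A morphism $\theta:\mathcal A\to\mathcal B^+$ maps letters to non-empty words and is extended by concatenation to words and to $\mathcal A^{\mathbb Z}$. $\sigma$ is the left shift. A directive sequence is a sequence $\boldsymbol\theta=(\theta^{(n)})_{n\ge 0}$ of morphisms $\theta^{(n)}:\mathcal A_{n+1}\to\mathcal A_n^+$; the alphabets are of bounded size if $\sup_n|\mathcal A_n|<\infty$. Put $\theta^{[n,N)}=\theta^{(n)}\circ\cdots\circ\theta^{(N-1)}$. $X^{(n)}_{\boldsymbol\theta}$ is the set of $x\in\mathcal A_n^{\mathbb Z}$ all of whose finite subwords are subwords of $\theta^{[n,N)}(a)$ for some $N>n$ and $a\in\mathcal A_N$; $X_{\boldsymbol\theta}=X^{(0)}_{\boldsymbol\theta}$. $\boldsymbol\theta$ is constant-length with length sequence $(q_n)$ if $|\theta^{(n)}(a)|=q_n$ for all $n$ and all $a\in\mathcal A_{n+1}$. $\boldsymbol\theta$ is torsion-free if it is constant-length with length sequence $(q_n)$, $q_n>1$ for infinitely many $n$, each $(X^{(n)}_{\boldsymbol\theta},\sigma)$ is minimal, $X^{(0)}_{\boldsymbol\theta}$ is aperiodic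 (contains no $\sigma$-periodic point), and every prime dividing some $q_k$ divides $q_n$ for infinitely many $n$. With $p_0=1$ and $p_n=q_0\cdots q_{n-1}$, $\mathbb Z_{(q_n)}=\varprojlim\mathbb Z/p_n\mathbb Z$, a compact topological group, with the map $+1$. A factor map is a continuous surjection commuting with the dynamics. A constant-length $\boldsymbol\theta$ with length sequence $(q_n)$ and all $(X^{(n)}_{\boldsymbol\theta},\sigma)$ minimal is quasi-recognizable if there is a factor map $(X_{\boldsymbol\theta},\sigma)\to(\mathbb Z_{(q_n)},+1)$. *)

(* Defs.v *)
From mathcomp Require Import all_boot all_order all_algebra.
From mathcomp Require Import all_classical all_reals all_analysis.

Set Implicit Arguments.
Unset Strict Implicit.
Unset Printing Implicit Defensive.

Import Order.TTheory GRing.Theory Num.Theory.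

Local Open Scope classical_set_scope.

(* Sub-systems [(X, f)] are given by a subset [X] of an ambient space [T]; as
   [X] is closed in all uses, "closed in X" and "closed in T" agree.  A minimal
   system is non-empty. *)
Definition minimal_system (T : topologicalType) (X : set T) (f : T -> T) : Prop :=
  X !=set0 /\
  (forall Y : set T,
     Y `<=` X -> closed Y -> f @` Y = Y -> Y !=set0 -> Y = X).

(* Only the restriction of [pi] to [X] is relevant. *)
Definition factor_map (T U : topologicalType)
    (X : set T) (f : T -> T) (Y : set U) (g : U -> U) (pi : T -> U) : Prop :=
  [/\ {within X, continuous pi},
      pi @` X = Y
    & forall x, X x -> pi (f x) = g (pi x)].

Definition fullshift (B : finType) : topologicalType :=
  {ptws int -> discrete_topology B}.

Definition shift (B : finType) (x : fullshift B) : fullshift B :=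
  fun i : int => x (i + 1)%R.

Definition subword_at (B : finType) (x : fullshift B) (i : int) (m : nat) : seq B :=
  [seq x (i + j%:Z)%R | j <- iota 0 m].

Definition aperiodic (B : finType) (X : set (fullshift B)) : Prop :=
  forall x k, X x -> 0 < k -> iter k (@shift B) x <> x.

Record morphism (B C : finType) : Type := Morphism {
  letter_image :> B -> seq C;
  letter_image_nonempty : forall b, 0 < size (letter_image b)
}.

Definition word_image (B C : finType) (theta : B -> seq C) (w : seq B) : seq C :=
  flatten [seq theta b | b <- w].

Definition directive_sequence (A : nat -> finType) : Type :=
  forall n, morphism (A n.+1) (A n).

(* [theta_range theta n k] is the action on letters of
   theta^[n, N) = theta^(n) o ... o theta^(N-1) for N = k + n. *)
Fixpoint theta_range (A : nat -> finType) (theta : directive_sequence A)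
    (n k : nat) : A (k + n) -> seq (A n) :=
  match k return A (k + n) -> seq (A n) with
  | 0 => fun a => [:: a]
  | k'.+1 => fun a => word_image (@theta_range A theta n k') (theta (k' + n) a)
  end.
Arguments theta_range {A} theta n k _.

Definition Xlevel (A : nat -> finType) (theta : directive_sequence A)
    (n : nat) : set (fullshift (A n)) :=
  [set x | forall i m, exists k, exists a : A (k + n),
     0 < k /\ infix (subword_at x i m) (theta_range theta n k a)].

Arguments Xlevel {A} theta n _.

Definition bounded_alphabets (A : nat -> finType) : Prop :=
  exists M, forall n, #|A n| <= M.

Definition constant_length (A : nat -> finType) (theta : directive_sequence A)
    (q : nat -> nat) : Prop :=
  forall n (a : A n.+1), size (theta n a) = q n.

Definition all_levels_minimal (A : nat -> finType)
    (theta : directive_sequence A) : Prop :=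
  forall n, minimal_system (Xlevel theta n) (@shift (A n)).

Definition torsion_free (A : nat -> finType) (theta : directive_sequence A)
    (q : nat -> nat) : Prop :=
  [/\ constant_length theta q,
      forall m, exists2 n, m <= n & 1 < q n,
      all_levels_minimal theta,
      aperiodic (Xlevel theta 0)
    & forall p k, prime p -> p %| q k ->
        forall m, exists2 n, m <= n & p %| q n].

Definition pprod (q : nat -> nat) (n : nat) : nat := \prod_(i < n) q i.

(* Z/p_n Z is encoded by canonical residues in ['I_(p_n)], with +1 being the
   cyclic successor [ordS]; ['Z_(p_n)] would be wrong for p_n = 1. *)
Definition residue_product (q : nat -> nat) : topologicalType :=
  prod_topology (fun n => discrete_topology 'I_(pprod q n)).

Definition residue (q : nat -> nat) (z : residue_product q) (n : nat) :
  'I_(pprod q n) := z n.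

Definition odometer_space (q : nat -> nat) : set (residue_product q) :=
  [set z | forall n, residue z n.+1 = residue z n %[mod pprod q n]].

Arguments odometer_space q _ : clear implicits.

Definition odometer_succ (q : nat -> nat) (z : residue_product q) :
  residue_product q := fun n => ordS (residue z n).
Arguments odometer_succ q z : clear implicits.

Definition quasi_recognizable (A : nat -> finType)
    (theta : directive_sequence A) (q : nat -> nat) : Prop :=
  [/\ constant_length theta q,
      all_levels_minimal theta
    & exists pi : fullshift (A 0) -> residue_product q,
        factor_map (Xlevel theta 0) (@shift (A 0))
          (odometer_space q) (odometer_succ q) pi].

(* Main.v *)
(* Let T_n be the image of X^(n) under theta^[0,n) and p_n = q_0 ... q_(n-1).
   T_n is closed, minimal under sigma^(p_n), and {k | sigma^k T_n = T_n} is
   c_n Z for some divisor c_n of p_n; the factor map exists as soon as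
   c_n = p_n for all n, since x then has a well-defined phase k mod p_n with
   x in sigma^k T_n.  By minimality c_n = gcd(c_N, p_n) for n <= N.  Hence if
   c_n < p_n for some n, a prime l dividing p_n / c_n satisfies
   l^(e+1) | p_N / c_N as soon as p_n l^e | p_N; since l divides infinitely many
   q_k, the quotients p_N / c_N are unbounded.  But they are bounded: every
   window [j c_N, j c_N + p_N) of a point x of T_N is the image of a letter of
   A_N, so with at most M letters two such windows with |j - j'| <= M agree, and
   if p_N / c_N >= M! + M these local periods, all dividing M! c_N, cover x and
   make it periodic. *)
Require Import Defs.
From mathcomp Require Import all_boot all_order all_algebra.
From mathcomp Require Import all_classical all_reals all_analysis.
From mathcomp Require Import zify.

Set Implicit Arguments.
Unset Strict Implicit.
Unset Printing Implicit Defensive.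

Import Order.TTheory GRing.Theory Num.Theory.

Local Open Scope classical_set_scope.

(** * Continuity into products of discrete spaces *)

Lemma near_coordinate (I : eqType) (K : I -> choiceType)
    (x : prod_topology (fun i => discrete_topology (K i))) (i : I) :
  \forall y \near x, y i = x i.
Proof.
have /(_ [set x i]) :=
  @proj_continuous I (fun i => discrete_topology (K i)) i x.
by apply; exact: discrete_set1.
Qed.

Lemma continuous_locally_constant (I : eqType) (K : I -> choiceType)
    (T : topologicalType) (D : set T)
    (f : T -> prod_topology (fun i => discrete_topology (K i))) :
  (forall x i, D x -> \forall y \near x, D y -> f y i = f x i) ->
  {within D, continuous f}.
Proof.
move=> fP; apply/subspace_continuousP => x Dx.
apply/cvg_sup => i U [V [[W oW <-] Wx WU]].
have := fP x i Dx; apply: filterS => y fyx Dy; apply: WU.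
by suff: W (f y i) by []; rewrite (fyx Dy).
Qed.

(** * The two-sided full shift and its finite windows *)

Section FullShift.
Context {B : finType}.
Implicit Types (x y : fullshift B) (a b i : int).

Definition zshift a x : fullshift B := fun i : int => x (i + a)%R.

Lemma zshift0 x : zshift 0%R x = x.
Proof. by apply/funext => i; rewrite /zshift addr0. Qed.

Lemma zshiftD a b x : zshift a (zshift b x) = zshift (a + b)%R x.
Proof. by apply/funext => i; rewrite /zshift addrA. Qed.

Lemma shiftE x : Defs.shift x = zshift 1%R x. Proof. by []. Qed.

Lemma iter_shift k x : iter k (@Defs.shift B) x = zshift k%:Z x.
Proof.
elim: k => [|k IH]; first by rewrite zshift0.
by rewrite iterS IH shiftE zshiftD; congr zshift; lia.
Qed.

Lemma fullshift_compact : compact [set: fullshift B].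
Proof.
have cB : compact [set: discrete_topology B].
  by apply: finite_compact; exact: (@finite_finset B).
have := @tychonoff int (fun=> discrete_topology B) (fun=> setT) (fun=> cB).
by congr compact; apply/seteqP; split.
Qed.

Lemma fullshift_hausdorff : hausdorff_space (fullshift B).
Proof. by apply: hausdorff_product => i; exact: discrete_hausdorff. Qed.

Lemma size_subword x i m : size (subword_at x i m) = m.
Proof. by rewrite size_map size_iota. Qed.

Lemma nth_subword c x i m j :
  (j < m)%N -> nth c (subword_at x i m) j = x (i + j%:Z)%R.
Proof. by move=> jm; rewrite (nth_map 0%N) ?size_iota// nth_iota. Qed.

Lemma subword_cat x i m n :
  subword_at x i (m + n) = subword_at x i m ++ subword_at x (i + m%:Z)%R n.
Proof.
rewrite /subword_at iotaD map_cat add0n; congr cat.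
rewrite -[m in iota m]addn0 iotaDl -map_comp; apply: eq_map => j /=.
by congr x; lia.
Qed.

Lemma subword_infix x i m j n : (i <= j)%R -> (j + n%:Z <= i + m%:Z)%R ->
  infix (subword_at x j n) (subword_at x i m).
Proof.
move=> ij jn.
have -> : m = (`|(j - i)%R| + n + `|(i + m%:Z - (j + n%:Z))%R|)%N by lia.
rewrite !subword_cat.
have -> : (i + `|(j - i)%R|%N%:Z)%R = j by lia.
by rewrite -catA; exact: infix_infix.
Qed.

Lemma near_letter x i : \forall y \near x, y i = x i.
Proof. exact: (@near_coordinate int (fun=> B)). Qed.

Lemma near_subword x i m :
  \forall y \near x, subword_at y i m = subword_at x i m.
Proof.
elim: m => [|m IH]; first exact: (@nearW _ (nbhs x)).
apply: filterS2 IH (near_letter x (i + m%:Z)%R) => y ym yi.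
by rewrite -addn1 !subword_cat ym /subword_at /= addr0 yi.
Qed.

Lemma subword_zshift a x i m :
  subword_at (zshift a x) i m = subword_at x (i + a)%R m.
Proof. by apply: eq_map => j; rewrite /zshift addrAC. Qed.

End FullShift.

(** * Constant-length morphisms on words and on two-sided sequences *)

Lemma word_image_cat (B C : finType) (f : B -> seq C) (u v : seq B) :
  word_image f (u ++ v) = word_image f u ++ word_image f v.
Proof. by rewrite /word_image map_cat flatten_cat. Qed.

Lemma word_image_infix (B C : finType) (f : B -> seq C) (u v : seq B) :
  infix u v -> infix (word_image f u) (word_image f v).
Proof.
by case/infixP => [s1 [s2 ->]]; rewrite !word_image_cat infix_infix.
Qed.

Lemma word_image_comp (B C D : finType) (f : C -> seq D) (g : B -> seq C)
    (u : seq B) :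
  word_image f (word_image g u) = word_image (fun b => word_image f (g b)) u.
Proof.
by elim: u => //= b u IH; rewrite {1}/word_image /= -/(word_image _ _)
  word_image_cat IH.
Qed.

Section Expand.
Context {B C : finType} (c : C) (q : nat) (f : B -> seq C).
Hypothesis q_gt0 : (0 < q)%N.
Hypothesis size_f : forall b, size (f b) = q.
Implicit Type y : fullshift B.

(* The default [c] of [nth] is never reached: [f] has constant length [q]. *)
Definition expand y : fullshift C :=
  fun i : int => nth c (f (y (i %/ q)%Z)) `|(i %% q)%Z|%N.

Lemma expand_block y (k : int) (r : nat) : (r < q)%N ->
  expand y (k * q%:Z + r%:Z)%R = nth c (f (y k)) r.
Proof.
move=> rq; rewrite /expand divzMDl ?modzMDl; last lia.
by rewrite divz_small ?addr0 ?modz_small//; lia.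
Qed.

Lemma expand_zshift y (k : int) :
  zshift (k * q%:Z)%R (expand y) = expand (zshift k y).
Proof.
apply/funext => i; rewrite /zshift [in LHS](divz_eq i q).
rewrite [in RHS](divz_eq i q).
have r0 : (0 <= (i %% q)%Z)%R by rewrite modz_ge0//; lia.
have rq : (`|(i %% q)%Z|%N < q)%N.
  by have := @ltz_pmod i q; move/(_ q_gt0); lia.
have -> : (i %% q)%Z = Posz `|(i %% q)%Z|%N by lia.
by rewrite addrAC -mulrDl !expand_block.
Qed.

Lemma expand_subword y (i : int) (m : nat) :
  subword_at (expand y) (i * q%:Z)%R (m * q) = word_image f (subword_at y i m).
Proof.
elim: m => [|m IH]; first by [].
rewrite mulSnr -[m.+1]addn1 !subword_cat IH word_image_cat; congr cat.
rewrite /word_image /= cats0 addr0.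
apply: (@eq_from_nth _ c) => [|j]; first by rewrite size_subword size_f.
rewrite size_subword => jq; rewrite nth_subword//.
by rewrite PoszM -mulrDl expand_block.
Qed.

Lemma expand_continuous : continuous expand.
Proof.
apply/continuous_subspace_setT.
apply: (@continuous_locally_constant int (fun=> C) (fullshift B)) => x i _.
by apply: filterS (near_letter x (i %/ q)%Z) => y e _; rewrite /expand e.
Qed.

End Expand.

(** A window is a locally constant function of the point, so violating [P] at one window is an open
    condition. *)
Lemma closed_fullshiftP (B : finType) (P : int -> nat -> seq B -> Prop) :
  closed [set x : fullshift B | forall i m, P i m (subword_at x i m)].
Proof.
rewrite closedE => x /= nx i m; apply: contrapT => nP; apply: nx.
by apply: filterS (near_subword x i m) => y e /(_ i m); rewrite e.
Qed.

Lemma zshift_continuous (B : finType) (a : int) :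
  continuous (@zshift B a).
Proof.
apply/continuous_subspace_setT.
apply: (@continuous_locally_constant int (fun=> B) (fullshift B)) => x i _.
by apply: filterS (near_letter x (i + a)%R) => y e _; rewrite /zshift e.
Qed.

(** * The level systems X^(n) and the passage from level n+1 to level n *)

Section Levels.
Context {A : nat -> finType} (theta : directive_sequence A).

Lemma Xlevel_closed n : closed (Xlevel theta n).
Proof.
exact: (@closed_fullshiftP _ (fun i m w => exists k, exists a : A (k + n),
     (0 < k)%N /\ infix w (theta_range theta n k a))).
Qed.

Lemma Xlevel_zshift n a x : Xlevel theta n x -> Xlevel theta n (zshift a x).
Proof. by move=> Xx i m; rewrite subword_zshift; exact: Xx. Qed.

(** [k + n.+1] and [k.+1 + n] are equal but not convertible, so letters must be transported between
    the two alphabets. *)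
Lemma letter_image_cast m m' (e : m = m') (eS : m.+1 = m'.+1) (a : A m.+1) :
  theta m' (ecast i (A i) eS a) =
  map (fun b => ecast i (A i) e b) (theta m a) :> seq _.
Proof.
by case: m' / e eS => eS; rewrite (eq_axiomK eS) /= map_id.
Qed.

(** The recursion of [theta_range] splits off the morphism of highest index; splitting off theta^(n)
    instead is what links level n to level n+1. *)
Lemma theta_range_shift n k (e : k + n.+1 = k.+1 + n) (a : A (k + n.+1)) :
  theta_range theta n k.+1 (ecast i (A i) e a) =
  word_image (theta n) (theta_range theta n.+1 k a).
Proof.
elim: k e a => [|k IH] e a.
  by rewrite (eq_axiomK e) /= /word_image /= cats0 flatten_seq1.
have e' : k + n.+1 = k.+1 + n by lia.
rewrite [LHS]/= -/(theta_range theta n k.+1) (letter_image_cast e').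
rewrite [theta_range _ _ _ _]/= word_image_comp /word_image -map_comp.
by congr flatten; apply: eq_map => b; exact: (IH e' b).
Qed.

Lemma Xlevel_expand n (c : A n) q : (0 < q)%N ->
  (forall b, size (theta n b) = q) ->
  forall y, Xlevel theta n.+1 y -> Xlevel theta n (expand c q (theta n) y).
Proof.
move=> q0 sz y Xy i m.
(* One letter more than [m] allows for the offset of [i] inside its block; [m.+1] blocks suffice
   because q >= 1. *)
have [k [a [k0 inf]]] := Xy (i %/ q)%Z m.+1.
have e : k + n.+1 = k.+1 + n by lia.
exists k.+1, (ecast i (A i) e a); split=> //.
rewrite theta_range_shift; apply: infix_trans (word_image_infix _ inf).
rewrite -(expand_subword c q0 sz); apply: subword_infix.
- by apply: lez_floor; lia.
- have := divz_eq i q; have := @ltz_pmod i q q0; nia.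
Qed.

End Levels.

(** * Divisibility of the products p_n, and subgroups of the integers *)

Lemma pprodS (q : nat -> nat) n : pprod q n.+1 = pprod q n * q n.
Proof. by rewrite /pprod big_ord_recr. Qed.

Lemma pprod_gt0 (q : nat -> nat) n :
  (forall k, 0 < q k) -> 0 < pprod q n.
Proof. by move=> q_gt0; exact: prodn_gt0. Qed.

Lemma dvdn_pprod (q : nat -> nat) n m : n <= m -> pprod q n %| pprod q m.
Proof.
move/subnK <-; elim: (m - n) => [|k IH]; first by rewrite add0n.
by rewrite addSn pprodS dvdn_mulr.
Qed.

(** The least positive element works, by Euclidean division. Applied to return times, this yields
    c_n. *)
Lemma int_subgroup_generator (S : int -> Prop) (a : nat) :
  (0 < a)%N -> S (Posz a) -> (forall k l, S k -> S l -> S (k + l)%R) ->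
  (forall k, S k -> S (- k)%R) ->
  exists2 g : nat, (0 < g)%N & forall k, S k <-> (Posz g %| k)%Z.
Proof.
move=> a0 Sa SD SN.
have ex : exists g, (0 < g)%N && `[< S (Posz g) >].
  by exists a; rewrite a0; apply/asboolP.
case: (ex_minnP ex) => g /andP[g0 /asboolP Sg] gmin.
have Smul k (l : nat) : S k -> S (k * l%:Z)%R.
  move=> Sk; elim: l => [|l IH].
    by rewrite mulr0 -(subrr k); apply: SD => //; exact: SN.
  by rewrite -addn1 PoszD mulrDr mulr1; exact: SD.
have Szmul k (l : int) : S k -> S (k * l)%R.
  case: l => l Sk; first exact: Smul.
  by rewrite NegzE mulrN; apply: SN; exact: Smul.
exists g => // k.
split=> [Sk|/dvdzP[l ->]]; last by rewrite mulrC; exact: Szmul.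
have r0 : (0 <= (k %% g)%Z)%R by rewrite modz_ge0//; lia.
have rg : ((k %% g)%Z < g)%R by rewrite ltz_pmod.
have Sr : S (k %% g)%Z.
  have -> : (k %% g)%Z = (k + g%:Z * (- (k %/ g)%Z))%R.
    by rewrite {2}(divz_eq k g); lia.
  by apply: SD => //; exact: Szmul.
apply/dvdz_mod0P; apply: contrapT => /eqP rn0.
have := gmin `|(k %% g)%Z|%N; rewrite gez0_abs// => /(_ _)/wrap[]; last lia.
by apply/andP; split; [lia|exact/asboolP].
Qed.

(** The prime divides some q_k, hence infinitely many; each further one contributes a factor [l]. *)
Lemma pprod_prime_power (q : nat -> nat) (l n e : nat) :
  prime l -> l %| pprod q n ->
  (forall l k, prime l -> l %| q k -> forall m, exists2 n, m <= n & l %| q n) ->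
  exists2 N, n <= N & pprod q n * l ^ e %| pprod q N.
Proof.
move=> l_prime ln recur.
have [k lk] : exists k, l %| q k.
  elim: n ln => [|n IH].
    by rewrite /pprod big_ord0 dvdn1 => /eqP l1; rewrite l1 in l_prime.
  by rewrite pprodS Euclid_dvdM// => /orP[/IH//|]; exists n.
elim: e => [|e [N nN IH]]; first by exists n; rewrite // expn0 muln1.
have [m Nm lm] := recur l k l_prime lk N.
exists m.+1; first lia.
rewrite pprodS expnSr mulnA dvdn_mul//.
exact: dvdn_trans IH (dvdn_pprod q Nm).
Qed.

(** * The sets T_n: closedness, nesting and minimality *)

Section Tower.
Context {A : nat -> finType} (theta : directive_sequence A) (q : nat -> nat).
Context (c : forall n, A n).
Hypothesis q_gt0 : forall n, (0 < q n)%N.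
Hypothesis size_theta : constant_length theta q.
Hypothesis theta_min : all_levels_minimal theta.

Local Notation p := (pprod q).
Local Notation X := (Xlevel theta).

Fixpoint tower n : fullshift (A n) -> fullshift (A 0) :=
  match n with
  | 0 => id
  | n'.+1 => fun y => tower (expand (c n') (q n') (theta n') y)
  end.

Lemma tower_zshift n (k : int) (y : fullshift (A n)) :
  zshift (k * (p n)%:Z)%R (tower y) = tower (zshift k y).
Proof.
elim: n k y => [|n IH] k y; first by rewrite /pprod big_ord0 mulr1.
by rewrite /= pprodS PoszM mulrA mulrAC IH expand_zshift.
Qed.

Lemma tower_continuous n : continuous (@tower n).
Proof.
elim: n => [|n IH] /=; first by move=> x; exact: cvg_id.
move=> x; apply: (@continuous_comp _ _ _ (expand (c n) (q n) (theta n))).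
  exact: expand_continuous.
exact: IH.
Qed.

Lemma tower_block n (y y' : fullshift (A n)) (k k' : int) (r : nat) :
  (r < p n)%N -> y k = y' k' ->
  tower y (k * (p n)%:Z + r%:Z)%R = tower y' (k' * (p n)%:Z + r%:Z)%R.
Proof.
elim: n y y' k k' r => [|n IH] y y' k k' r.
  rewrite /pprod big_ord0 /= => r0 e.
  have -> : r = 0%N by lia.
  by rewrite !mulr1 !addr0.
rewrite pprodS => rp e /=.
have pn0 := pprod_gt0 n q_gt0.
have sq : (r %/ p n < q n)%N by rewrite ltn_divLR// mulnC.
(* A block of length p_(n+1) consists of q_n blocks of length p_n; the quotient of [r] by p_n
   selects a letter of theta^(n)(y k). *)
have split_index (j : int) : (j * (p n * q n)%N%:Z + r%:Z =
    (j * (q n)%:Z + (r %/ p n)%N%:Z) * (p n)%:Z + (r %% p n)%N%:Z)%R.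
  by rewrite {1}(divn_eq r (p n)); lia.
rewrite !split_index; apply: IH; first by rewrite ltn_mod.
by rewrite !expand_block// e.
Qed.

(* The set T_n of the header. *)
Definition base n : set (fullshift (A 0)) := @tower n @` X n.

Lemma base0 : base 0 = X 0.
Proof. exact: image_id. Qed.

Lemma base_closed n : closed (base n).
Proof.
apply: compact_closed; first exact: fullshift_hausdorff.
apply: continuous_compact.
  by apply: continuous_subspaceT; exact: tower_continuous.
apply: subclosed_compact (@fullshift_compact (A n)) _ => //.
exact: Xlevel_closed.
Qed.

Lemma base_neq0 n : base n !=set0.
Proof. by have [[y Xy] _] := theta_min n; exists (tower y); exists y. Qed.

Lemma base_subset n m : n <= m -> base m `<=` base n.
Proof.
move/subnK <-; elim: (m - n) => [|k IH]; first by rewrite add0n.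
move=> _ [y Xy <-]; apply: IH; rewrite addSn in y Xy *.
by exists (expand (c (k + n)) (q (k + n)) (theta (k + n)) y) => //;
  exact: Xlevel_expand.
Qed.

Lemma base_zshift n (k : int) x :
  base n x -> base n (zshift (k * (p n)%:Z)%R x).
Proof.
move=> [y Xy <-]; exists (zshift k y); first exact: Xlevel_zshift.
by rewrite tower_zshift.
Qed.

(** The preimage of [Y] in X^(n) is closed and non-empty, and minimality of X^(n) applies.
    Invariance is asked in both directions because [minimal_system] tests sets equal to their
    image. *)
Lemma base_minimal n (Y : set (fullshift (A 0))) :
  closed Y -> (exists2 x, base n x & Y x) ->
  (forall x, Y x -> Y (zshift (p n)%:Z x)) ->
  (forall x, Y x -> Y (zshift (- (p n)%:Z)%R x)) ->
  base n `<=` Y.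
Proof.
move=> Yclosed [_ [y0 Xy0 <-] Yy0] Yp Yn.
have zshift_tower (y : fullshift (A n)) :
    tower (zshift 1%R y) = zshift (p n)%:Z (tower y) /\
    tower (zshift (-1)%R y) = zshift (- (p n)%:Z)%R (tower y).
  by rewrite -!tower_zshift mul1r mulN1r.
pose Z := X n `&` (@tower n @^-1` Y).
have ZX : Z = X n.
  have [_] := theta_min n; apply.
  - by move=> y [].
  - apply: closedI; first exact: Xlevel_closed.
    apply: preimage_closed => // y _; exact: tower_continuous.
  - apply/seteqP; split=> [_ [y [Xy Yy] <-]|y [Xy Yy]].
      rewrite shiftE; split; first exact: Xlevel_zshift.
      by rewrite /= (zshift_tower y).1; exact: Yp.
    exists (zshift (-1)%R y); last by rewrite shiftE zshiftD zshift0.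
    split; first exact: Xlevel_zshift.
    by rewrite /= (zshift_tower y).2; exact: Yn.
  - by exists y0.
by move=> _ [y Xy <-]; move: Xy; rewrite -ZX => -[].
Qed.

(** * Return times of T_n and their dependence on n *)

Definition base_return n (k : int) := exists2 x, base n x & base n (zshift k x).

(** The points of T_n sent back into T_n by sigma^k form a closed set invariant under sigma^(p_n)
    and its inverse. Hence return times form a group. *)
Lemma base_return_all n k x :
  base_return n k -> base n x -> base n (zshift k x).
Proof.
move=> [x0 bx0 bkx0]; move: x; apply: base_minimal.
- apply: preimage_closed; last exact: base_closed.
  by move=> y _; exact: zshift_continuous.
- by exists x0.
- move=> x /(base_zshift 1%R); rewrite mul1r.
  by rewrite /= !zshiftD addrC.
- move=> x /(base_zshift (-1)%R); rewrite mulN1r.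
  by rewrite /= !zshiftD addrC.
Qed.

Lemma base_returnD n k l :
  base_return n k -> base_return n l -> base_return n (k + l)%R.
Proof.
move=> kn [x bx lx]; exists x => //.
by rewrite -zshiftD; exact: base_return_all kn lx.
Qed.

Lemma base_returnN n k : base_return n k -> base_return n (- k)%R.
Proof.
by move=> [x bx kx]; exists (zshift k x); rewrite // zshiftD addNr zshift0.
Qed.

Lemma base_return_pprod n (k : int) : base_return n (k * (p n)%:Z)%R.
Proof. by have [x bx] := base_neq0 n; exists x => //; exact: base_zshift. Qed.

Lemma base_return_subset n m k : n <= m -> base_return m k -> base_return n k.
Proof.
by move=> nm [x bx kx]; exists x; exact: (base_subset nm).
Qed.

Lemma base_cover n m x : n <= m -> base n x ->
  exists j : int, base m (zshift (j * (p n)%:Z)%R x).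
Proof.
move=> nm; move: x.
suff : base n `<=` [set x | exists j : int, base m (zshift (j * (p n)%:Z)%R x)].
  by [].
have pm0 := pprod_gt0 m q_gt0.
apply: base_minimal.
(* Since sigma^(p_m) preserves T_m, only [j] modulo p_m matters: the union is finite, hence
   closed. *)
- rewrite (_ : mkset _ =
      \bigcup_(j in `I_(p m)) (zshift (j%:Z * (p n)%:Z)%R @^-1` base m)).
    apply: closed_bigcup; first exact: finite_II.
    move=> j _; apply: (@preimage_closed (fullshift (A 0)) (fullshift (A 0))).
      by move=> y _; exact: zshift_continuous.
    exact: base_closed.
  apply/seteqP; split=> [x [j bj]|x [j _ bj]]; last by exists (Posz j).
  have r0 : (0 <= (j %% p m)%Z)%R by rewrite modz_ge0//; lia.
  have rp : ((j %% p m)%Z < p m)%R by rewrite ltz_pmod.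
  exists `|(j %% p m)%Z|%N; first by rewrite /=; lia.
  have := base_zshift (- (j %/ p m)%Z * (p n)%:Z)%R bj.
  rewrite zshiftD /preimage /= (gez0_abs r0).
  rewrite (_ : (_ + _)%R = ((j %% p m)%Z * (p n)%:Z)%R)//.
  by rewrite {2}(divz_eq j (p m)); lia.
- have [x bx] := base_neq0 m; exists x; first exact: (base_subset nm).
  by exists 0%R; rewrite mul0r zshift0.
- move=> x [j bj]; exists (j - 1)%R; rewrite zshiftD.
  by have -> : ((j - 1) * (p n)%:Z + (p n)%:Z = j * (p n)%:Z)%R by lia.
- move=> x [j bj]; exists (j + 1)%R; rewrite zshiftD.
  by have -> : ((j + 1) * (p n)%:Z + - (p n)%:Z = j * (p n)%:Z)%R by lia.
Qed.

(** Together with [base_return_subset] this amounts to c_n = gcd(c_m, p_n). *)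
Lemma base_return_lift n m k : n <= m -> base_return n k ->
  exists j : int, base_return m (k + j * (p n)%:Z)%R.
Proof.
move=> nm kn; have [x bx] := base_neq0 m.
have [j bj] := base_cover nm (base_return_all kn (base_subset nm bx)).
by exists j, x; rewrite // addrC -zshiftD.
Qed.

(** * Periodicity from large quotients, and the equality c_n = p_n *)

Lemma base_period n (M g d : nat) x :
  (#|A n| <= M)%N -> (0 < g)%N ->
  (forall k, (Posz g %| k)%Z -> base_return n k) ->
  p n = (g * d)%N -> (M`! + M <= d)%N ->
  base n x -> zshift (M`! * g)%N x = x.
Proof.
move=> AM g0 gret pd dM bx.
have /choice[y yP] : forall j : int, exists y : fullshift (A n),
    tower y = zshift (j * g%:Z)%R x.
  move=> j; have : base_return n (j * g%:Z)%R by apply: gret; exact: dvdz_mull.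
  by move=> /base_return_all/(_ bx)[y _ <-]; exists y.
(* The letter of [y j] at 0 determines [x] on the window of length p_n starting at [j * g]. *)
have same_letter (j j' : int) r : y j 0%R = y j' 0%R -> (r < p n)%N ->
    x (j * g%:Z + r%:Z)%R = x (j' * g%:Z + r%:Z)%R.
  move=> e rp; have := tower_block rp e.
  by rewrite !yP /zshift !mul0r !add0r ![(r%:Z + _)%R]addrC.
apply/funext => i; rewrite /zshift.
have rho0 : (0 <= (i %% g)%Z)%R by rewrite modz_ge0//; lia.
have rhog : ((i %% g)%Z < g)%R by rewrite ltz_pmod.
have iE := divz_eq i g.
set I := (i %/ g)%Z in iE; set rho := (i %% g)%Z in iE rho0 rhog.
(* Pigeonhole on the M+1 windows starting at blocks I-M, ..., I, all of them at or before the block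
   of [i]. *)
have [s [s' [ss' ay]]] : exists s s' : 'I_M.+1, (s < s')%N /\
    y (I - M%:Z + s%:Z)%R 0%R = y (I - M%:Z + s'%:Z)%R 0%R.
  pose a (s : 'I_M.+1) := y (I - M%:Z + s%:Z)%R 0%R.
  have : ~~ injectiveb a.
    apply/negP => /injectiveP/leq_card; rewrite card_ord => /leq_trans/(_ AM).
    by rewrite ltnn.
  move=> /injectivePn[s [s' sns' ass']].
  have : (s < s')%N || (s' < s)%N by rewrite -neq_ltn.
  by case/orP => lt; [exists s, s'|exists s', s].
have [w wE] : exists w, M`! = (w * (s' - s))%N.
  apply/dvdnP; apply: dvdn_fact.
  by have := ltn_ord s'; lia.
set delta := (s' - s)%N in wE.
have s'E : Posz s' = (s%:Z + delta%:Z)%R by rewrite /delta; lia.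
have delta0 : (0 < delta)%N by rewrite subn_gt0.
(* The shift by [M! * g] is made in [w] steps of length [delta * g]. *)
suff H u : (u <= w)%N -> x (i + (u * delta * g)%N%:Z)%R = x i.
  by rewrite wE; exact: H.
elim: u => [|u IH] uw; first by rewrite !mul0n addr0.
rewrite -{}IH; last exact: ltnW.
have sM := ltn_ord s.
(* [r] is the offset of i + u delta g in the window of [s], and also that of i + (u+1) delta g in
   the window of [s']. *)
have [r rE] : exists r : nat,
    Posz r = (rho + ((u * delta)%N%:Z + M%:Z - s%:Z) * g%:Z)%R.
  exists (`|rho|%N + (u * delta + (M - s)) * g)%N.
  rewrite PoszD PoszM gez0_abs//; congr (_ + _ * _)%R.
  by rewrite PoszD; lia.
have rp : (r < p n)%N.
  (* As delta >= 1, this gives u delta + (M - s) + 1 <= M! + M <= d, so the offset stays inside the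
     window. *)
  have uM : (u * delta + delta <= M`!)%N.
    by rewrite wE -mulSnr leq_mul2r uw orbT.
  have : ((u * delta + (M - s)).+1 * g <= p n)%N.
    by rewrite pd mulnC leq_mul2l; apply/orP; right; lia.
  have : Posz r = (rho + ((u * delta + (M - s))%N%:Z) * g%:Z)%R.
    by rewrite rE; congr (_ + _ * _)%R; rewrite PoszD; lia.
  by move: (u * delta + (M - s))%N => E; rewrite mulSn; lia.
have e1 : ((I - M%:Z + s%:Z) * g%:Z + r%:Z = i + (u * delta * g)%N%:Z)%R.
  by rewrite rE [in RHS]iE; lia.
have e2 : ((I - M%:Z + s'%:Z) * g%:Z + r%:Z = i + (u.+1 * delta * g)%N%:Z)%R.
  by rewrite rE s'E [in RHS]iE mulSn mulnDl; lia.
by rewrite -e1 -e2; apply/esym; exact: same_letter.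
Qed.

Lemma base_return_dvd (M : nat) :
  (forall n, (#|A n| <= M)%N) -> aperiodic (X 0) ->
  (forall l k, prime l -> l %| q k -> forall m, exists2 n, m <= n & l %| q n) ->
  forall n k, base_return n k -> (p n %| k)%Z.
Proof.
move=> AM aper recur n.
have gen m : exists2 g : nat, (0 < g)%N &
    forall k, base_return m k <-> (Posz g %| k)%Z.
  apply: (@int_subgroup_generator _ (p m)); first exact: pprod_gt0.
  - by rewrite -[Posz _]mul1r; exact: base_return_pprod.
  - exact: base_returnD.
  - exact: base_returnN.
have [g g0 gP] := gen n.
have gp : g %| p n.
  by have /gP := base_return_pprod n 1%R; rewrite mul1r.
suff gE : g = p n by move=> k /gP; rewrite gE.
apply/eqP; apply: contraT => gNp.
have [u pu] := dvdnP gp.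
have pn0 := pprod_gt0 n q_gt0.
have u1 : (1 < u)%N.
  by case: u pu => [|[|u]] // pu; rewrite pu ?mul1n ?eqxx// in gNp pn0.
have l_prime := pdiv_prime u1; set l := pdiv u in l_prime.
have [u' uE] : exists u', u = (u' * l)%N by apply/dvdnP; exact: pdiv_dvd.
have lp : l %| p n by rewrite pu uE dvdn_mulr// dvdn_mull.
(* Since l^e > e, having l^e divide p_N / c_N makes that quotient large enough for [base_period]. *)
pose e := (M`! + M)%N.
have [N nN pN] := pprod_prime_power e l_prime lp recur.
have [h h0 hP] := gen N.
have gh : g %| h.
  by have /gP := base_return_subset nN ((hP h).2 (dvdzz _)).
(* Here g = c_n and h = c_N. As [g * l] divides p_n, if it also divided c_N it would divide g, by
   lifting the return time g to level N. *)
have glNh : ~~ (g * l %| h).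
  apply/negP => glh.
  have [j /hP hj] := base_return_lift nN ((gP g).2 (dvdzz _)).
  have glp : g * l %| p n by rewrite pu uE -mulnA [(l * g)%N]mulnC dvdn_mull.
  have : (Posz (g * l)%N %| Posz g)%Z.
    rewrite -[Posz g](addrK (j * (p n)%:Z)%R); apply: rpredB.
      exact: dvdz_trans hj.
    exact: dvdz_mull.
  rewrite /= => /dvdn_leq -/(_ g0).
  by rewrite leqNgt ltn_Pmulr// prime_gt1.
have [w hw] := dvdnP gh.
have lw : ~~ (l %| w).
  by apply: contra glNh => lw; rewrite hw mulnC dvdn_pmul2r.
have hpN : h %| p N.
  by have /hP := base_return_pprod N 1%R; rewrite mul1r.
have [d pd] := dvdnP hpN.
have d0 : (0 < d)%N.
  by have := pprod_gt0 N q_gt0; rewrite pd; case: (d).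
(* l^e divides p_N / g = w d, and [l] is coprime to w = h / g. *)
have led : l ^ e %| d.
  have : l ^ e %| w * d.
    have -> : (w * d = p N %/ g)%N.
      by rewrite pd hw mulnA mulnK// mulnC.
    rewrite dvdn_divRL; last exact: dvdn_trans gh hpN.
    by apply: dvdn_trans pN; rewrite mulnC dvdn_mul.
  by rewrite Gauss_dvdr// coprimeXl// prime_coprime.
have ed : (e <= d)%N.
  apply: leq_trans (dvdn_leq d0 led); apply: ltnW.
  exact: ltn_expl (prime_gt1 l_prime).
have [x bx] := base_neq0 N.
have per : zshift (M`! * h)%N x = x.
  apply: (@base_period N M h d) => //; last by rewrite mulnC.
  by move=> k /hP.
have x0 : X 0 x by rewrite -base0; exact: (base_subset (leq0n N)).
case: (aper x (M`! * h)%N x0); first by rewrite muln_gt0 fact_gt0.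
by rewrite iter_shift.
Qed.

(** * The phase modulo p_n and the factor map onto the odometer *)

Section Phase.
Hypothesis return_dvd : forall n k, base_return n k -> (p n %| k)%Z.

Lemma base_congr n (a b : int) x : (p n %| (b - a)%R)%Z ->
  base n (zshift a x) -> base n (zshift b x).
Proof.
by move=> /dvdzP[k kE] /(base_zshift k); rewrite zshiftD -kE subrK.
Qed.

Lemma base_dvd n (a b : int) x :
  base n (zshift a x) -> base n (zshift b x) -> (p n %| (b - a)%R)%Z.
Proof.
move=> ba bb; apply: return_dvd; exists (zshift a x) => //.
by rewrite zshiftD subrK.
Qed.

(* Off [X 0] no residue need qualify, and [xget] returns the junk value [0]. *)
Definition phase n x : 'I_(p n) :=
  xget (Ordinal (pprod_gt0 n q_gt0))
    [set k : 'I_(p n) | base n (zshift (- k%:Z)%R x)].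

Lemma phase_base n x : X 0 x -> base n (zshift (- (phase n x)%:Z)%R x).
Proof.
rewrite -base0 => /(base_cover (leq0n n))[j].
(* As p_0 = 1, the cover gives an arbitrary shift [j]; the residue of -j modulo p_n is then
   admissible. *)
rewrite /pprod big_ord0 mulr1 => bj.
have pn0 := pprod_gt0 n q_gt0.
have r0 : (0 <= ((- j)%R %% p n)%Z)%R by rewrite modz_ge0//; lia.
have rp : (((- j)%R %% p n)%Z < p n)%R by rewrite ltz_pmod.
have kp : (`|((- j)%R %% p n)%Z|%N < p n)%N by lia.
apply: (@xgetPex _ (Ordinal (pprod_gt0 n q_gt0))
  [set k : 'I_(p n) | base n (zshift (- k%:Z)%R x)]).
exists (Ordinal kp); apply: base_congr bj => /=.
rewrite gez0_abs//; apply/dvdzP; exists ((- j)%R %/ p n)%Z.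
by have := divz_eq (- j)%R (p n); lia.
Qed.

Lemma phase_unique n x (k : 'I_(p n)) :
  X 0 x -> base n (zshift (- k%:Z)%R x) -> phase n x = k.
Proof.
move=> Xx bk; apply/val_inj => /=.
have := base_dvd bk (phase_base n Xx); rewrite opprK addrC -eqz_mod_dvd.
by rewrite !modz_nat => /eqP[]; rewrite !modn_small// => ->.
Qed.

Lemma phase_shift n x : X 0 x -> phase n (Defs.shift x) = ordS (phase n x).
Proof.
move=> Xx; apply: phase_unique; first by rewrite shiftE; exact: Xlevel_zshift.
rewrite shiftE zshiftD; apply: base_congr (phase_base n Xx).
apply/dvdzP; exists (Posz ((phase n x).+1 %/ p n)%N).
by have /= := divn_eq (phase n x).+1 (p n); lia.
Qed.

(** Points admitting a residue other than that of [x] form a finite union of closed sets, which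
    misses [x] by uniqueness of the phase. *)
Lemma phase_locally_constant n x :
  X 0 x -> \forall y \near x, X 0 y -> phase n y = phase n x.
Proof.
move=> Xx.
pose F := \bigcup_(k in [set k | k != phase n x])
  (zshift (- k%:Z)%R @^-1` base n).
have F_closed : closed F.
  apply: closed_bigcup; first exact: finite_finset.
  move=> k _; apply: preimage_closed; last exact: base_closed.
  by move=> y _; exact: zshift_continuous.
have : nbhs x (~` F).
  apply: open_nbhs_nbhs; split; first exact: closed_openC.
  by move=> [k /= /eqP kx bk]; apply: kx; rewrite (phase_unique Xx bk).
apply: filterS => y nFy Xy; apply: contrapT => /eqP yx.
by apply: nFy; exists (phase n y) => //; exact: phase_base.
Qed.

Definition odometer_phase (x : fullshift (A 0)) : residue_product q :=
  fun n => phase n x.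

Lemma odometer_phase_continuous : {within X 0, continuous odometer_phase}.
Proof.
apply: (@continuous_locally_constant nat (fun n => 'I_(p n)) (fullshift (A 0))).
by move=> x n Xx; exact: phase_locally_constant.
Qed.

Lemma odometer_phase_image : odometer_phase @` X 0 = odometer_space q.
Proof.
apply/seteqP; split=> [_ [x Xx <-] n|z zodo].
  have bx := base_subset (leqnSn n) (phase_base n.+1 Xx).
  have := base_dvd bx (phase_base n Xx).
  rewrite opprK addrC -eqz_mod_dvd.
  by rewrite !modz_nat => /eqP[].
have zshift_ex n : exists x, base n (zshift (- (z n)%:Z)%R x).
  have [x bx] := base_neq0 n; exists (zshift (z n)%:Z x).
  by rewrite zshiftD addNr zshift0.
have [x_ x_P] := choice zshift_ex.
(* The sets sigma^(z_n) T_n decrease because z_m = z_n modulo p_n; a cluster point of the chosen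
   [x_ n] then lies in all of them. *)
have base_step n m x : n <= m ->
    base m (zshift (- (z m)%:Z)%R x) -> base n (zshift (- (z n)%:Z)%R x).
  move/subnK <-; elim: (m - n) => [|k IH]; first by rewrite add0n.
  move=> bm; apply: IH; apply: base_congr (base_subset (leqnSn _) bm).
  rewrite opprK addrC -eqz_mod_dvd !modz_nat.
  exact/eqP/(congr1 Posz)/zodo.
have [x [_ xclust]] := @fullshift_compact (A 0) (x_ @ \oo)%classic _ filterT.
have bx n : base n (zshift (- (z n)%:Z)%R x).
  have : closed (zshift (- (z n)%:Z)%R @^-1` base n).
    apply: preimage_closed; last exact: base_closed.
    by move=> y _; exact: zshift_continuous.
  apply; move: xclust; rewrite clusterE; apply.
  by exists n => // m /= nm; apply: base_step nm _.
have Xx : X 0 x.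
  rewrite -base0 -[x]zshift0; apply: base_congr (bx 0).
  by move: (_ - _)%R => a; rewrite /pprod big_ord0 dvd1z.
exists x => //; apply: functional_extensionality_dep => n.
exact: phase_unique.
Qed.

End Phase.
End Tower.

Theorem theorem9 (A : nat -> finType) (theta : directive_sequence A)
    (q : nat -> nat) :
  bounded_alphabets A -> torsion_free theta q -> quasi_recognizable theta q.
Proof.
move=> [M AM] [size_theta _ theta_min aper recur]; split=> //.
(* Minimal systems are non-empty, which supplies the default letters and, since letter images are
   non-empty, gives q_n > 0. *)
have letter n : A n by have [x _] := cid (theta_min n).1; exact: (x 0%R).
have q_gt0 n : 0 < q n.
  by rewrite -(size_theta n (letter n.+1)); exact: letter_image_nonempty.
have return_dvd :=
  base_return_dvd (c := letter) q_gt0 size_theta theta_min AM aper recur.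
exists (odometer_phase theta letter q_gt0); split.
- exact: odometer_phase_continuous.
- exact: odometer_phase_image.
- by move=> x Xx; apply: functional_extensionality_dep => n; exact: phase_shift.
Qed.
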